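(* Let $(S,\mathfrak m_S,k)$ and $(T,\mathfrak m_T,k)$ be commutative noetherian local rings with common residue field $k$, with $S\neq k\neq T$, and let $R:=S\times_k T$ be their fiber product over $k$. Let $M$ be a finitely generated $R$-module. If $\operatorname{Ext}_R^i(M,M\oplus R)=0$ for all $i\geq 1$, then $M$ is free over $R$.
   Context: Let $\pi_S\colon S\to k$ and $\pi_T\colon T\to k$ be the natural surjections onto the common residue field. The fiber product is $R=S\times_kT=\{(s,t)\in S\times T\mid \pi_S(s)=\pi_T(t)\}$, a commutative noetherian local ring with maximal ideal $\mathfrak m_R=\mathfrak m_S\oplus\mathfrak m_T$ and residue field $k$. The assumption $S\neq k\neq T$ means $\mathfrak m_S\neq 0$ and $\mathfrak m_T\neq 0$. The zero module is free. *)

(* Defs.v *)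
From HB Require Import structures.
From mathcomp Require Import all_boot all_order all_algebra finmap.
From mathcomp.multinomials Require monalg.

Set Implicit Arguments.
Unset Strict Implicit.
Unset Printing Implicit Defensive.

Import GRing.Theory.
Local Open Scope ring_scope.

Section LocalRings.
Variable A : comNzRingType.
Implicit Types I J m : A -> Prop.

Definition is_ideal I : Prop :=
  [/\ I 0, forall x y, I x -> I y -> I (x + y) & forall a x, I x -> I (a * x)].

Definition noetherian : Prop :=
  forall I, is_ideal I ->
    exists (n : nat) (g : 'I_n -> A),
      forall x, I x <-> exists c : 'I_n -> A, x = \sum_i c i * g i.

Definition maximal_ideal m : Prop :=
  [/\ is_ideal m, ~ m 1
    & forall J, is_ideal J -> (forall x, m x -> J x) -> ~ J 1 ->
        forall x, J x -> m x].

Definition local_at m : Prop :=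
  maximal_ideal m /\
  forall m', maximal_ideal m' -> forall x, m' x <-> m x.

(* (A, m, k), where k is identified with A / m through the surjection pi. *)
Definition noetherian_local_ring m (k : fieldType) (pi : {rmorphism A -> k}) :
    Prop :=
  [/\ noetherian, local_at m, forall c, exists x, pi x = c
    & forall x, m x <-> pi x = 0].

End LocalRings.

Section FiberProduct.
Variables (S T : comNzRingType) (k : fieldType).
Variables (piS : {rmorphism S -> k}) (piT : {rmorphism T -> k}).

Definition fiber_pred : {pred S * T} := fun st => piS st.1 == piT st.2.

Lemma fiber_subring : subring_closed fiber_pred.
Proof.
split=> [|x y|x y]; rewrite /fiber_pred !unfold_in /=.
- by rewrite !rmorph1.
- by rewrite !rmorphB => /eqP-> /eqP->.
- by rewrite !rmorphM => /eqP-> /eqP->.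
Qed.

HB.instance Definition _ :=
  GRing.isSubringClosed.Build (S * T)%type fiber_pred fiber_subring.

Record fiber_product : predArgType :=
  FiberProduct { fiber_val : S * T; _ : fiber_val \in fiber_pred }.

HB.instance Definition _ := [isSub for fiber_val].
HB.instance Definition _ := [Choice of fiber_product by <:].
HB.instance Definition _ := [SubChoice_isSubComNzRing of fiber_product by <:].

End FiberProduct.

Section Modules.
Variable R : nzRingType.

Definition finitely_generated (M : lmodType R) : Prop :=
  exists (n : nat) (g : 'I_n -> M),
    forall x, exists c : 'I_n -> R, x = \sum_i c i *: g i.

(* The basis is indexed by an arbitrary type; the zero module is free on the
   empty one. *)
Definition is_free (M : lmodType R) : Prop :=
  exists (I : eqType) (b : I -> M),
    (forall x, exists (s : seq I) (c : I -> R), x = \sum_(i <- s) c i *: b i)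
    /\ (forall (s : seq I) (c : I -> R), uniq s ->
          \sum_(i <- s) c i *: b i = 0 -> forall i, i \in s -> c i = 0).

Definition projective (P : lmodType R) : Prop :=
  forall (A B : lmodType R) (g : {linear A -> B}) (f : {linear P -> B}),
    (forall y, exists x, g x = y) ->
    exists h : {linear P -> A}, forall x, g (h x) = f x.

Record proj_resolution (M : lmodType R) := ProjResolution {
  res_mod :> nat -> lmodType R;
  res_aug : {linear res_mod 0 -> M};
  res_d : forall n, {linear res_mod n.+1 -> res_mod n};
  res_proj : forall n, projective (res_mod n);
  res_aug_surj : forall x, exists y, res_aug y = x;
  res_exact0 : forall y, res_aug y = 0 <-> exists z, res_d 0 z = y;
  res_exact : forall n y, res_d n y = 0 <-> exists z, res_d n.+1 z = y }.

Section Ext.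
Variables (M N : lmodType R) (P : proj_resolution M).

Definition cocycle i (f : {linear P i -> N}) : Prop :=
  forall x, f (res_d P i x) = 0.

Definition coboundary i : {linear P i -> N} -> Prop :=
  match i with
  | 0 => fun f => forall x, f x = 0
  | j.+1 => fun f =>
      exists g : {linear P j -> N}, forall x, f x = g (res_d P j x)
  end.

(* The i-th cohomology of the complex Hom_R(P, N) is zero. *)
Definition cohomology_eq0 i : Prop :=
  forall f : {linear P i -> N}, cocycle f -> coboundary f.

End Ext.

(* Ext^i_R(M, N) = 0. Projective resolutions exist (proj_resolution_exists) and
   the choice of one is immaterial (Ext_eq0E). *)
Definition Ext_eq0 i (M N : lmodType R) : Prop :=
  forall P : proj_resolution M, cohomology_eq0 N P i.

End Modules.

Arguments res_proj [R M] _ n.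
Arguments res_aug_surj [R M] _ x.
Arguments res_exact0 [R M] _ y.
Arguments res_exact [R M] _ n y.

Section Kernel.
Variables (R : nzRingType) (U V : lmodType R) (f : {linear U -> V}).

Definition ker_pred : {pred U} := fun x => f x == 0.

Lemma ker_submod : submod_closed ker_pred.
Proof.
split=> [|a x y]; rewrite /ker_pred !unfold_in ?linear0 //.
by move=> /eqP fx /eqP fy; rewrite linearP fx fy scaler0 addr0.
Qed.

HB.instance Definition _ := GRing.isSubmodClosed.Build R U ker_pred ker_submod.

Record kernel : predArgType := Kernel { ker_val : U; _ : ker_val \in ker_pred }.

HB.instance Definition _ := [isSub for ker_val].
HB.instance Definition _ := [Choice of kernel by <:].
HB.instance Definition _ := [SubChoice_isSubLmodule of kernel by <:].

Lemma ker_val_linear : linear ker_val.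
Proof. by []. Qed.

HB.instance Definition _ :=
  GRing.isLinear.Build R kernel U _ ker_val ker_val_linear.

Lemma ker_valE (x : kernel) : f (ker_val x) = 0.
Proof. by case: x => x /= /eqP. Qed.

Section Corestriction.
Variables (W : lmodType R) (g : {linear W -> U}).
Hypothesis fg0 : forall x, f (g x) = 0.

Lemma corestr_subproof x : g x \in ker_pred.
Proof. by rewrite unfold_in; apply/eqP. Qed.

Definition corestr x : kernel := Kernel (corestr_subproof x).

Lemma corestr_linear : linear corestr.
Proof. by move=> a x y; apply: val_inj; rewrite /= linearP. Qed.

HB.instance Definition _ :=
  GRing.isLinear.Build R W kernel _ corestr corestr_linear.

End Corestriction.
End Kernel.

Lemma linear_factor (R : nzRingType) (A B N : lmodType R)
    (g : {linear A -> B}) (f : {linear A -> N}) :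
    (forall y, exists x, g x = y) -> (forall x, g x = 0 -> f x = 0) ->
  exists h : {linear B -> N}, forall x, h (g x) = f x.
Proof.
move=> g_surj ker_gf.
have sP y : exists x, g x == y by have [x <-] := g_surj y; exists x.
pose s y := xchoose (sP y).
have gs y : g (s y) = y by apply/eqP/(xchooseP (sP y)).
have fs x : f (s (g x)) = f x.
  by apply/eqP; rewrite -subr_eq0 -linearB ker_gf // linearB gs subrr.
have h_lin : linear (f \o s).
  by move=> a x y; rewrite /= -linearP -[RHS]fs linearP !gs.
pose hL := GRing.isLinear.Build R B N _ (f \o s) h_lin.
pose h : {linear B -> N} := HB.pack (f \o s) hL.
by exists h.
Qed.

Section FreeCover.
Import monalg.
Local Open Scope fset_scope.
Variables (R : nzRingType) (K : choiceType).
Notation F := {malg R[K]}.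

Section Extension.
Variables (V : lmodType R) (h : K -> V).

Definition lin_ext (g : F) : V := \sum_(x <- msupp g) g@_x *: h x.

Lemma lin_extEw (g : F) (d : {fset K}) : msupp g `<=` d ->
  lin_ext g = \sum_(x <- d) g@_x *: h x.
Proof.
move=> le_d; apply: big_fset_incl => // x _ x_out.
by rewrite mcoeff_outdom ?scale0r.
Qed.

Lemma lin_ext_linear : linear lin_ext.
Proof.
move=> a g1 g2; pose d := msupp (a *: g1 + g2) `|` (msupp g1 `|` msupp g2).
have [d0 d1 d2] : [/\ msupp (a *: g1 + g2) `<=` d, msupp g1 `<=` d
    & msupp g2 `<=` d].
  by split; apply/fsubsetP=> x xg; rewrite !inE xg ?orbT.
rewrite (lin_extEw d0) (lin_extEw d1) (lin_extEw d2).
rewrite scaler_sumr -big_split; apply: eq_bigr => x _ /=.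
by rewrite mcoeffD mcoeffZ scalerDl scalerA.
Qed.

HB.instance Definition _ := GRing.isLinear.Build R F V _ lin_ext lin_ext_linear.

Lemma lin_extU x : lin_ext << x >> = h x.
Proof.
by rewrite (@lin_extEw _ [fset x]) ?msuppU_le // big_seq_fset1 mcoeffUU scale1r.
Qed.

End Extension.

Lemma linear_malgE (V : lmodType R) (f : {linear F -> V}) g :
  f g = lin_ext (fun x => f << x >>) g.
Proof.
rewrite [g in LHS]monalgE linear_sum; apply: eq_bigr => x _; rewrite -linearZ.
congr (f _); apply/malgP=> y.
by rewrite mcoeffZ !mcoeffU mulr_natr.
Qed.

Lemma malg_projective : projective F.
Proof.
move=> A B g f g_surj.
have sP x : exists a, g a == f << x >>.
  by have [a <-] := g_surj (f << x >>); exists a.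
exists (lin_ext (fun x => xchoose (sP x))) => m.
have /= -> := linear_malgE (g \o lin_ext (fun x => xchoose (sP x))) m.
rewrite (linear_malgE f); apply: eq_bigr => x _ /=.
by rewrite lin_extU; congr (_ *: _); apply/eqP/(xchooseP (sP x)).
Qed.

Definition free_module : lmodType R := F.

End FreeCover.

Lemma proj_resolution_exists (R : nzRingType) (M : lmodType R) :
  inhabited (proj_resolution M).
Proof.
pose F (Z : lmodType R) := free_module R Z.
pose aug (Z : lmodType R) : {linear F Z -> Z} := lin_ext (@id Z).
have aug_surj Z z : exists y, aug Z y = z.
  by exists (monalg.mkmalgU z 1); exact: (lin_extU id z).
pose Z n : lmodType R := iter n (fun Z => kernel (aug Z)) M.
pose d n : {linear F (Z n.+1) -> F (Z n)} :=
  @ker_val _ _ _ (aug (Z n)) \o aug (Z n.+1).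
have exact n y : aug (Z n) y = 0 <-> exists z, d n z = y.
  split=> [y0|[z <-]]; last exact: ker_valE.
  have yP : y \in ker_pred (aug (Z n)) by rewrite unfold_in y0.
  have [z zE] := aug_surj (Z n.+1) (Kernel yP).
  by exists z; rewrite /d /= zE.
constructor; apply: (@ProjResolution R M (fun n => F (Z n)) (aug M) d).
- by move=> n; apply: malg_projective.
- exact: aug_surj.
- exact: (exact 0).
- move=> n y; rewrite -exact; split=> [y0|]; last by move=> y0; rewrite /d /= y0.
  exact: val_inj.
Qed.

Section Independence.
Variable R : nzRingType.

Section Shift.
Variables (M : lmodType R) (P : proj_resolution M).

Lemma res_augK x : res_aug P (res_d P 0 x) = 0.
Proof. by apply/res_exact0; exists x. Qed.

Definition syzygy : lmodType R := kernel (res_aug P).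

Definition syz_aug : {linear P 1 -> syzygy} := corestr res_augK.

Lemma syz_aug_surj z : exists y, syz_aug y = z.
Proof.
have [y yE] := (res_exact0 P (ker_val z)).1 (ker_valE z).
by exists y; apply: val_inj.
Qed.

Lemma syz_exact0 y : syz_aug y = 0 <-> exists z, res_d P 1 z = y.
Proof.
rewrite -res_exact; split=> [/(congr1 val)//|y0]; exact: val_inj.
Qed.

Definition shift : proj_resolution syzygy :=
  @ProjResolution R syzygy (fun n => P n.+1) syz_aug (fun n => res_d P n.+1)
    (fun n => res_proj P n.+1) syz_aug_surj syz_exact0
    (fun n => res_exact P n.+1).

Lemma cohomology_shift N i :
  cohomology_eq0 N P i.+2 = cohomology_eq0 N shift i.+1.
Proof. by []. Qed.

Lemma cohomology1P N : cohomology_eq0 N P 1 <->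
  forall f : {linear syzygy -> N},
    exists g : {linear P 0 -> N}, forall z, f z = g (ker_val z).
Proof.
split=> [H f|H f f0].
  have [|g gE] := H (f \o syz_aug).
    move=> x /=; have -> : syz_aug (res_d P 1 x) = 0; last exact: linear0.
    by apply/syz_exact0; exists x.
  by exists g => z; have [y <-] := syz_aug_surj z; have /= -> := gE y.
have [|h hE] := @linear_factor R _ _ N syz_aug f syz_aug_surj.
  by move=> x /syz_exact0[z <-].
by have [g gE] := H h; exists g => x; rewrite -hE gE.
Qed.

Lemma cohomology0P N :
  cohomology_eq0 N P 0 <-> forall (f : {linear M -> N}) x, f x = 0.
Proof.
split=> [H f x|H f f0 x].
  have [y <-] := res_aug_surj P x.
  by have /= := H (f \o res_aug P); apply=> z /=; rewrite res_augK linear0.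
have [|h hE] := @linear_factor R _ _ N (res_aug P) f (res_aug_surj P).
  by move=> y /res_exact0[z <-].
by rewrite -hE H.
Qed.

End Shift.

(* Modulo maps through the projective module W, M is a retract of M'. *)
Lemma cohomology_retract N i (M M' W : lmodType R)
    (P : proj_resolution M) (Q : proj_resolution M')
    (u : {linear M -> M'}) (v : {linear M' -> M})
    (a : {linear M -> W}) (b : {linear W -> M}) :
    projective W -> (forall x, x = v (u x) + b (a x)) ->
  cohomology_eq0 N Q i.+1 -> cohomology_eq0 N P i.+1.
Proof.
elim: i M M' W P Q u v a b => [|i IHi] M M' W P Q u v a b projW uvE HQ.
all: have [u0 u0E] :=
  res_proj P 0 _ _ (res_aug Q) (u \o res_aug P) (res_aug_surj Q).
all: have [v0 v0E] :=
  res_proj Q 0 _ _ (res_aug P) (v \o res_aug Q) (res_aug_surj P).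
all: have [c cE] := projW _ _ (res_aug P) b (res_aug_surj P).
all: simpl in u0E, v0E.
all: have u1P (z : syzygy P) : res_aug Q ((u0 \o @ker_val _ _ _ _) z) = 0
  by rewrite /= u0E ker_valE linear0.
all: have v1P (z : syzygy Q) : res_aug P ((v0 \o @ker_val _ _ _ _) z) = 0
  by rewrite /= v0E ker_valE linear0.
all: pose u1 : {linear syzygy P -> syzygy Q} := corestr u1P.
all: pose v1 : {linear syzygy Q -> syzygy P} := corestr v1P.
all: have w0P x :
  res_aug P ((idfun \- ((v0 \o u0) \+ (c \o (a \o res_aug P)))) x) = 0
  by rewrite /= linearB linearD v0E u0E cE -uvE subrr.
all: pose w0 : {linear P 0 -> syzygy P} := corestr w0P.
all: have uv1E z : z = v1 (u1 z) + w0 (ker_val z)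
  by apply: val_inj; rewrite /= ker_valE !linear0 addr0 addrC subrK.
- apply/cohomology1P => f; have [h hE] := (cohomology1P Q N).1 HQ (f \o v1).
  exists ((h \o u0) \+ (f \o w0)) => z /=.
  by rewrite {1}[z]uv1E linearD; have /= -> := hE (u1 z).
- rewrite cohomology_shift.
  exact: (IHi _ _ (P 0) (shift P) (shift Q) u1 v1 (@ker_val _ _ _ _) w0
            (res_proj P 0) uv1E).
Qed.

Theorem Ext_eq0E i (M N : lmodType R) (P : proj_resolution M) :
  Ext_eq0 i M N <-> cohomology_eq0 N P i.
Proof.
split=> [H|HP Q]; first exact: H.
case: i HP => [|i] HP; first by apply/cohomology0P/(cohomology0P P).
apply: (@cohomology_retract N i M M (P 0) Q P idfun idfun \0 \0
  (res_proj P 0) _ HP).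
by move=> x /=; rewrite addr0.
Qed.

End Independence.

(* Main.v *)
(* Write the maximal ideal of R as m = I (+) J, with I and J the maximal ideals
   of S and T, so that I J = 0. Let M_n be the n-th syzygy in a minimal free
   resolution F of M. Since Ext(M, R) = 0, the vanishing of Ext(M, M) passes to
   every M_n. An element x of M_2 lies in m F_1 = I F_1 (+) J F_1, and both its
   components are again in M_2. So if M_2 <> 0, then, up to exchanging I and J,
   there is an x in M_2 outside m M_2 with J x = 0. Choosing a minimal cover of
   M_2 that maps e_0 to x, one gets J e_0 inside M_3, and for b in J outside J^2
   the element b e_0 of M_3 is outside m M_3 and killed by I. Iterating, M_4 has
   an element outside m M_4 killed by J, so M_5 contains J e_0 as well. Sending
   w in M_5 to (J-component of w_0) e_0 defines a map M_5 -> M_3. As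
   Ext^1(M_4, M_3) = Ext^2(M_3, M_3) = 0, it extends to F_4; the image of e_0
   under the extension has a coordinate t in m with u = u t for all u in J,
   whence J = 0, a contradiction. If M_2 = 0 but M_1 <> 0, then Ext^1(M, R) <> 0
   by minimality. *)
Require Import Defs.
From HB Require Import structures.
From mathcomp Require Import all_boot all_order all_algebra.
From mathcomp Require Import boolp classical_sets.

Set Implicit Arguments.
Unset Strict Implicit.
Unset Printing Implicit Defensive.

Import GRing.Theory.
Local Open Scope ring_scope.

(** * Dimension shifting *)

Section SyzygyExt.
Variables (R : nzRingType) (F Z : lmodType R) (p : {linear F -> Z}).
Hypothesis p_surj : forall z, exists v, p v = z.

Section Prolongation.
Hypothesis projF : projective F.
Variable Q : proj_resolution (kernel p).

(** Inverse to [shift]: a resolution of [kernel p] is spliced with [F] in degree 0. Matching on the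
    degree makes the higher terms those of [Q] by conversion. *)
Definition prolong_mod n : lmodType R := if n is j.+1 then Q j else F.

Definition prolong_d n : {linear prolong_mod n.+1 -> prolong_mod n} :=
  match n return {linear prolong_mod n.+1 -> prolong_mod n} with
  | 0 => @ker_val _ _ _ p \o res_aug Q
  | j.+1 => res_d Q j
  end.

Lemma prolong_proj n : projective (prolong_mod n).
Proof. by case: n => [|n]; [exact: projF | exact: res_proj]. Qed.

Lemma prolong_exact0 v : p v = 0 <-> exists z, prolong_d 0 z = v.
Proof.
split=> [v0|[z <-]]; last exact: ker_valE.
have vP : v \in ker_pred p by rewrite unfold_in v0.
by have [z zE] := res_aug_surj Q (Kernel vP); exists z; rewrite /= zE.
Qed.

Lemma prolong_exact n v :
  prolong_d n v = 0 <-> exists z, prolong_d n.+1 z = v.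
Proof.
case: n v => [|n] v; last exact: res_exact.
by rewrite -res_exact0; split=> [v0|/= ->//]; exact: val_inj.
Qed.

Definition prolong : proj_resolution Z :=
  @ProjResolution R Z prolong_mod p prolong_d prolong_proj p_surj
    prolong_exact0 prolong_exact.

End Prolongation.

(** [Ext_eq0] ranges over all resolutions of [Z], hence covers the splice, whose degree [i.+2] is by
    conversion degree [i.+1] of [Q]. *)
Lemma Ext_eq0_kernel (N : lmodType R) i : projective F ->
  Ext_eq0 i.+2 Z N -> Ext_eq0 i.+1 (kernel p) N.
Proof. by move=> projF H Q; apply: (H (prolong projF Q)). Qed.

(** Exactness of Hom(F, N) -> Hom(ker p, N) -> Ext^1(Z, N), in the form that extends maps over a
    cover. *)
Lemma Ext1_eq0_extend (N : lmodType R) (f : {linear kernel p -> N}) :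
    projective F -> Ext_eq0 1 Z N ->
  exists g : {linear F -> N}, forall z, f z = g (ker_val z).
Proof.
move=> projF H; have [Q] := proj_resolution_exists (kernel p).
exact: (cohomology1P (prolong projF Q) N).1 (H _) f.
Qed.

(** Exactness of Ext^{i+1}(M, Z) -> Ext^{i+2}(M, ker p) -> Ext^{i+2}(M, F), by a diagram chase on
    cochains. *)
Lemma Ext_eq0_kernel_r (M : lmodType R) i :
  Ext_eq0 i.+1 M Z -> Ext_eq0 i.+2 M F -> Ext_eq0 i.+2 M (kernel p).
Proof.
move=> HZ HF P f f0.
have [x|h hE] := HF P (@ker_val _ _ _ p \o f); first by rewrite /= f0.
have [x|h' h'E] := HZ P (p \o h).
  by rewrite /= -hE; exact: ker_valE.
(* [h] bounds [f] but has values in [F]; subtracting the coboundary of a lift [h2] of [h'] moves it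
   into [kernel p] and leaves its own coboundary unchanged. *)
have [h2 h2E] := res_proj P i _ _ p h' p_surj.
have g0 x : p ((h \- (h2 \o res_d P i)) x) = 0.
  rewrite /= linearB h2E -h'E; exact: subrr.
exists (corestr g0) => x; apply: val_inj => /=.
have -> : res_d P i (res_d P i.+1 x) = 0 by apply/res_exact; exists x.
by rewrite linear0 subr0 -hE.
Qed.

End SyzygyExt.

(** * Finite free modules *)

Section FiniteFree.
Variable R : comNzRingType.

Definition lin_comb (V : lmodType R) n (g : 'I_n -> V) (v : 'rV[R]_n) : V :=
  \sum_i v 0 i *: g i.

Lemma lin_comb_linear (V : lmodType R) n (g : 'I_n -> V) : linear (lin_comb g).
Proof.
move=> a u v; rewrite /lin_comb scaler_sumr -big_split.
by apply: eq_bigr => i _; rewrite !mxE scalerDl scalerA.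
Qed.

HB.instance Definition _ (V : lmodType R) n (g : 'I_n -> V) :=
  GRing.isLinear.Build R 'rV[R]_n V _ (lin_comb g) (lin_comb_linear g).

Lemma lin_comb_delta (V : lmodType R) n (g : 'I_n -> V) i :
  lin_comb g (delta_mx 0 i) = g i.
Proof.
rewrite /lin_comb (bigD1 i) //= !mxE !eqxx scale1r big1 ?addr0 // => j ji.
by rewrite mxE (negPf ji) andbF scale0r.
Qed.

Lemma linear_rVE (V : lmodType R) n (f : {linear 'rV[R]_n -> V}) v :
  f v = lin_comb (fun i => f (delta_mx 0 i)) v.
Proof.
rewrite {1}(row_sum_delta v) linear_sum.
by apply: eq_bigr => i _; rewrite linearZ.
Qed.

Lemma rV_projective n : projective 'rV[R]_n.
Proof.
move=> A B g f g_surj.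
have [h hE] := fin_all_exists (fun i => g_surj (f (delta_mx 0 i))).
exists (lin_comb h) => v; rewrite (linear_rVE f) linear_sum.
by apply: eq_bigr => i _; rewrite linearZ hE.
Qed.

Lemma Ext_eq0_rV (M : lmodType R) n i :
  Ext_eq0 i.+1 M R^o -> Ext_eq0 i.+1 M 'rV[R]_n.
Proof.
move=> H P f f0.
have coord_lin j : linear (fun v : 'rV[R]_n => v 0 j : R^o).
  by move=> a u v; rewrite !mxE.
pose coordL j := GRing.isLinear.Build R 'rV[R]_n R^o _ _ (coord_lin j).
pose coord j : {linear 'rV[R]_n -> R^o} :=
  HB.pack (fun v : 'rV[R]_n => v 0 j : R^o) (coordL j).
have /fin_all_exists[g gE] j : exists g : {linear P i -> R^o},
    forall x, f x 0 j = g (res_d P i x).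
  by apply: (H P (coord j \o f)) => x; rewrite /= f0 mxE.
have h_lin : linear (fun y => \row_j g j y : 'rV[R]_n).
  by move=> a y z; apply/rowP=> j; rewrite !mxE linearP.
pose hL := GRing.isLinear.Build R (P i) 'rV[R]_n _ _ h_lin.
pose h : {linear P i -> 'rV[R]_n} :=
  HB.pack (fun y => \row_j g j y : 'rV[R]_n) hL.
exists h => x /=.
by apply/rowP=> j; rewrite mxE gE.
Qed.

End FiniteFree.

(** * Noetherian and local rings *)

Section Submodules.
Variables (R : comNzRingType) (V : lmodType R).
Implicit Types N L : V -> Prop.

Definition submodule N : Prop :=
  [/\ N 0, forall x y, N x -> N y -> N (x + y) & forall a x, N x -> N (a *: x)].

Definition generates N n (g : 'I_n -> V) : Prop :=
  (forall i, N (g i)) /\ forall x, N x -> exists c, x = \sum_i c i *: g i.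

Lemma submodule_sum N n (F : 'I_n -> V) :
  submodule N -> (forall i, N (F i)) -> N (\sum_i F i).
Proof. by move=> [N0 ND _] NF; apply: (big_ind N). Qed.

Lemma submoduleB N x y : submodule N -> N x -> N y -> N (x - y).
Proof.
by move=> [_ ND NZ] Nx Ny; rewrite -scaleN1r; apply: ND => //; apply: NZ.
Qed.

End Submodules.

Lemma ideal_generator (R : comNzRingType) (I : R -> Prop) n (g : 'I_n -> R) :
    (forall x, I x <-> exists c : 'I_n -> R, x = \sum_i c i * g i) ->
  forall i, I (g i).
Proof.
move=> gP i; apply/gP; exists (fun j => (j == i)%:R).
rewrite (bigD1 i) //= eqxx mul1r big1 ?addr0 // => j /negPf->.
by rewrite mul0r.
Qed.

(** Induction on the rank: lift to [N] generators of the ideal of first coordinates, and add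
    generators of the part of [N] with first coordinate 0. *)
Lemma noetherian_rV (R : comNzRingType) n (N : 'rV[R]_n -> Prop) :
  noetherian R -> submodule N -> exists p (g : 'I_p -> 'rV[R]_n), generates N g.
Proof.
move=> noethR; elim: n N => [|n IHn]; last rewrite -[n.+1]/(1 + n)%N.
all: move=> N subN; have [N0 ND NZ] := subN.
  exists 0, (fun=> 0); split=> // x _; exists (fun=> 0).
  by rewrite big_ord0; exact: thinmx0.
pose hd (x : 'rV[R]_(1 + n)) := lsubmx x 0 0.
have [|p [g gP]] := noethR (fun r => exists2 x : 'rV_(1 + n), N x & hd x = r).
  split; first by exists 0; rewrite // /hd !mxE.
    by move=> _ _ [x Nx <-] [y Ny <-]; exists (x + y); rewrite /hd ?mxE; auto.
  by move=> a _ [x Nx <-]; exists (a *: x); rewrite /hd ?mxE; auto.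
have /fin_all_exists[G GP] i : exists x : 'rV_(1 + n), N x /\ hd x = g i.
  by have [x Nx xE] := ideal_generator gP i; exists x.
have [|q [h [Nh hP]]] := IHn (fun y => N (row_mx (0 : 'M_1) y)).
  split=> [|x y Nx Ny|a x Nx]; first by rewrite row_mx0.
    by rewrite -[0]addr0 -add_row_mx; apply: ND.
  by rewrite -[0](scaler0 _ a) -scale_row_mx; apply: NZ.
pose gh (i : 'I_(p + q)) :=
  match split i with inl j => G j | inr j => row_mx (0 : 'M_1) (h j) end.
have ghl i : gh (lshift q i) = G i by rewrite /gh (unsplitK (inl i)).
have ghr i : gh (rshift p i) = row_mx 0 (h i) by rewrite /gh (unsplitK (inr i)).
exists (p + q)%N, gh; split=> [i|x Nx].
  by rewrite /gh; case: split => j //; exact: (GP j).1.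
have [|c cE] := (gP (hd x)).1; first by exists x.
pose y := x - \sum_i c i *: G i.
have Ny : N y.
  apply: submoduleB => //; apply: submodule_sum => // i; apply: NZ.
  exact: (GP i).1.
have yE : y = row_mx 0 (rsubmx y).
  rewrite -[LHS]hsubmxK; congr row_mx; apply/rowP=> i; rewrite !ord1.
  rewrite [RHS]mxE linearB linear_sum mxE -/(hd x) cE mxE summxE.
  by apply/eqP; rewrite subr_eq0; apply/eqP/eq_bigr => j _;
     rewrite linearZ mxE -(GP j).2.
have [|d dE] := hP (rsubmx y); first by rewrite -yE.
exists (fun i => match split i with inl j => c j | inr j => d j end).
rewrite big_split_ord /=.
under eq_bigr do rewrite (unsplitK (inl _)) ghl.
under [X in _ + X]eq_bigr do rewrite (unsplitK (inr _)) ghr.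
rewrite -[LHS](subrK (\sum_i c i *: G i)) addrC; congr (_ + _).
have row0D : forall u v : 'rV[R]_n,
      row_mx (0 : 'cV[R]_1) (u + v) = row_mx 0 u + row_mx 0 v.
  by move=> u v; rewrite add_row_mx addr0.
rewrite -/y yE dE (big_morph _ row0D (row_mx0 _ _ _ _)).
by apply: eq_bigr => i _; rewrite scale_row_mx scaler0.
Qed.

Section IdealProduct.
Variables (R : comNzRingType) (V : lmodType R).

(* [m N], as the smallest submodule containing the products: membership is then
   eliminated by exhibiting a submodule. *)
Definition ideal_prod (m : R -> Prop) (N : V -> Prop) (x : V) : Prop :=
  forall L : V -> Prop, submodule L ->
    (forall c z, m c -> N z -> L (c *: z)) -> L x.

Lemma ideal_prodM (m : R -> Prop) (N : V -> Prop) c z :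
  m c -> N z -> ideal_prod m N (c *: z).
Proof. by move=> mc Nz L _; apply. Qed.

Lemma submodule_ideal_prod (m : R -> Prop) (N : V -> Prop) :
  submodule (ideal_prod m N).
Proof.
split=> [L [] // | x y Hx Hy L subL H | a x Hx L subL H].
  by case: (subL) => _ LD _; apply: LD; [apply: Hx | apply: Hy].
by case: (subL) => _ _ LZ; apply: LZ; exact: Hx.
Qed.

(** The combinations with coefficients in [m] form a submodule containing all the products, so
    membership in [ideal_prod] can be eliminated into it. *)
Lemma ideal_prod_generates (m : R -> Prop) (N : V -> Prop) n (g : 'I_n -> V) x :
    is_ideal m -> generates N g -> ideal_prod m N x ->
  exists c, (forall i, m (c i)) /\ x = \sum_i c i *: g i.
Proof.
move=> [m0 mD mM] [_ gP] xP.
apply: (xP (fun x => exists c, (forall i, m (c i)) /\ x = \sum_i c i *: g i))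
  => {x xP}[|c z mc /gP[d ->]].
  split=> [|_ _ [c [mc ->]] [d [md ->]]|a _ [c [mc ->]]].
  - exists (fun=> 0); split=> //; rewrite big1 // => i _; exact: scale0r.
  - exists (fun i => c i + d i); split=> [i|]; first exact: mD.
    by rewrite -big_split; apply: eq_bigr => i _; rewrite scalerDl.
  - exists (fun i => a * c i); split=> [i|]; first exact: mM.
    by rewrite scaler_sumr; apply: eq_bigr => i _; rewrite scalerA.
exists (fun i => c * d i); split=> [i|].
  by rewrite mulrC; apply: mM.
by rewrite scaler_sumr; apply: eq_bigr => i _; rewrite scalerA.
Qed.

End IdealProduct.

(** * Nakayama's lemma and minimal generators over a local ring *)

Section LocalAlgebra.
Variables (R : comNzRingType) (m : R -> Prop).
Hypotheses (m_ideal : is_ideal m) (m_neq1 : ~ m 1).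
Hypothesis m_unit : forall x, m x \/ exists y, y * x = 1.
Variable V : lmodType R.
Implicit Type N : V -> Prop.

Lemma unit_subr x : m x -> exists y, y * (1 - x) = 1.
Proof.
move=> mx; case: (m_unit (1 - x)) => // m1x; case: m_neq1.
by rewrite -(subrK x 1); case: m_ideal => _ mD _; apply: mD.
Qed.

Lemma generates_drop N n (g : 'I_n.+1 -> V) (c : 'I_n.+1 -> R) i y :
    generates N g -> \sum_j c j *: g j = 0 -> y * c i = 1 ->
  generates N (g \o lift i).
Proof.
move=> [Ng gP] c0 yc; split=> [j|x /gP[d ->]]; first exact: Ng.
have gi : g i = - \sum_j (y * c (lift i j)) *: g (lift i j).
  apply/eqP; rewrite -addr_eq0; apply/eqP.
  transitivity (y *: \sum_j c j *: g j); last by rewrite c0 scaler0.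
  rewrite (bigD1_ord i) //= scalerDr scalerA yc scale1r scaler_sumr.
  by congr (_ + _); apply: eq_bigr => j _; rewrite scalerA.
exists (fun j => d (lift i j) - d i * (y * c (lift i j))).
rewrite (bigD1_ord i) //= gi scalerN scaler_sumr -sumrN -big_split.
by apply: eq_bigr => j _; rewrite /= scalerBl scalerA addrC.
Qed.

Lemma nakayama N n (g : 'I_n -> V) :
    generates N g -> (forall x, N x -> ideal_prod m N x) ->
  forall x, N x -> x = 0.
Proof.
elim: n g => [|n IHn] g gN NmN x Nx.
  by have [c ->] := gN.2 x Nx; rewrite big_ord0.
have [c [mc cE]] := ideal_prod_generates m_ideal gN (NmN _ (gN.1 ord0)).
have [y yc] := unit_subr (mc ord0).
have drop : generates N (g \o lift ord0).
  apply: (@generates_drop _ _ _ (fun i => (i == ord0)%:R - c i) ord0 y) => //.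
  under eq_bigr do rewrite scalerBl.
  rewrite sumrB -cE (bigD1 ord0) //= scale1r big1 ?addr0 ?subrr // => j.
  by move/negPf->; rewrite scale0r.
exact: IHn drop NmN x Nx.
Qed.

(** Start from the given family with [x] put in front, and drop generators other than [x] as long as
    some relation has a coefficient outside [m]. *)
Lemma minimal_generators_at n (g : 'I_n -> V) x :
    generates (fun=> True) g -> ~ ideal_prod m (fun=> True) x ->
  exists p (h : 'I_p.+1 -> V), [/\ h ord0 = x, generates (fun=> True) h
    & forall c, \sum_i c i *: h i = 0 -> forall i, m (c i)].
Proof.
move=> gV xP.
have : exists h : 'I_n.+1 -> V, h ord0 = x /\ generates (fun=> True) h.
  exists (fun i => oapp g x (unlift ord0 i)).
  split; first by rewrite unlift_none.
  split=> // z _; have [c ->] := gV.2 z I.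
  exists (fun i => oapp c 0 (unlift ord0 i)).
  rewrite big_ord_recl unlift_none /= scale0r add0r.
  by apply: eq_bigr => i _; rewrite !liftK.
(* The coefficient of [x] cannot be the only unit in a relation: solving for [x] would put it in the
   product of [m] with the module. *)
have head0 q (h : 'I_q.+1 -> V) c : h ord0 = x -> \sum_i c i *: h i = 0 ->
    (forall i, m (c (lift ord0 i))) -> m (c ord0).
  move=> hx c0 mc; case: (m_unit (c ord0)) => // -[y yc]; case: xP.
  have [_ _ subZ] := submodule_ideal_prod m (fun _ : V => True).
  rewrite -[x]scale1r -yc -scalerA; apply: (subZ y).
  have -> : c ord0 *: x = \sum_i (- c (lift ord0 i)) *: h (lift ord0 i).
    under eq_bigr do rewrite scaleNr.
    apply/eqP; rewrite sumrN -addr_eq0; apply/eqP.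
    by rewrite -[RHS]c0 big_ord_recl hx.
  apply: submodule_sum => [|i]; first exact: submodule_ideal_prod.
  apply: ideal_prodM => //; rewrite -mulN1r; case: m_ideal => _ _; exact.
elim: n {g gV} => [|n IHn] [h [hx hV]].
  exists 0, h; split=> // c c0 i; rewrite ord1.
  by apply: head0 c0 _ => // -[].
have [?|/existsNP[c /not_implyP[c0 /existsNP[i mci]]]] :=
  EM (forall c, \sum_i c i *: h i = 0 -> forall i, m (c i)).
  by exists n.+1, h.
have [j mcj] : exists j, ~ m (c (lift ord0 j)).
  apply/existsNP => mc; apply: mci; case: (unliftP ord0 i) => [j|] -> //.
  exact: head0 c0 mc.
have [/mcj//|[y yc]] := m_unit (c (lift ord0 j)).
apply: IHn; exists (h \o lift (lift ord0 j)); split; last first.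
  exact: generates_drop hV c0 yc.
by rewrite -hx; congr h; apply: val_inj.
Qed.

End LocalAlgebra.

(** * Finite free covers and self-orthogonal modules *)

Section Modules.
Variable R : comNzRingType.

Lemma is_free_rV (M : lmodType R) n (p : {linear 'rV[R]_n -> M}) :
  (forall x, exists v, p v = x) -> (forall v, p v = 0 -> v = 0) -> is_free M.
Proof.
move=> p_surj p_inj; exists 'I_n, (fun i => p (delta_mx 0 i)); split.
  move=> x; have [v <-] := p_surj x; exists (index_enum 'I_n), (v 0).
  exact: linear_rVE.
move=> s c s_uniq c0 i si.
have /rowP/(_ i) : \sum_(j <- s) c j *: delta_mx 0 j = 0 :> 'rV[R]_n.
  apply: p_inj; rewrite linear_sum -[RHS]c0.
  by apply: eq_bigr => j; rewrite linearZ.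
rewrite summxE mxE (bigD1_seq i) //= !mxE !eqxx mulr1 big1 ?addr0 // => j ji.
by rewrite !mxE eq_sym (negPf ji) andbF mulr0.
Qed.

Lemma finitely_generated_kernel (Z : lmodType R) n
    (p : {linear 'rV[R]_n -> Z}) :
  noetherian R -> finitely_generated (kernel p).
Proof.
move=> noethR.
have [|q [g [pg gP]]] := @noetherian_rV R n (fun v => p v = 0) noethR.
  split=> [|u v pu pv|a v pv]; first exact: linear0.
    by rewrite linearD pu pv addr0.
  by rewrite linearZ /= pv scaler0.
have kg i : g i \in ker_pred p by rewrite unfold_in pg.
exists q, (fun i => Kernel (kg i)) => z; have [c zE] := gP _ (ker_valE z).
by exists c; apply: val_inj; rewrite [LHS]zE linear_sum.
Qed.

Definition self_orthogonal (Z : lmodType R) : Prop :=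
  forall i, (1 <= i)%N -> Ext_eq0 i Z Z /\ Ext_eq0 i Z R^o.

(** With K the kernel, Ext^{i+1}(K, K) reduces to Ext^{i+2}(Z, K), which vanishes because
    Ext^{i+1}(Z, Z) and Ext^{i+2}(Z, R^n) do. *)
Lemma self_orthogonal_kernel (Z : lmodType R) n (p : {linear 'rV[R]_n -> Z}) :
    (forall z, exists v, p v = z) ->
  self_orthogonal Z -> self_orthogonal (kernel p).
Proof.
move=> p_surj orthZ [//|i] _; have projF := @rV_projective R n.
have [Ext1ZZ _] := orthZ i.+1 isT; have [Ext2ZZ Ext2ZR] := orthZ i.+2 isT.
split; last exact: Ext_eq0_kernel.
apply: Ext_eq0_kernel => //; apply: Ext_eq0_kernel_r => //.
exact: Ext_eq0_rV.
Qed.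

End Modules.

(** * Local rings with decomposable maximal ideal *)

Section DecomposableMaximalIdeal.
Variable R : comNzRingType.
Implicit Types I J : R -> Prop.

Definition sum_ideal I J x := exists a b, [/\ I a, J b & x = a + b].

(** Symmetric in [I] and [J], so that their roles can be exchanged. [dec_neq1] and [dec_unit]
    together say that R is local with maximal ideal I + J. *)
Record decomposable_local I J : Prop := DecomposableLocal {
  dec_noetherian : noetherian R;
  dec_ideall : is_ideal I;
  dec_idealr : is_ideal J;
  dec_cap : forall x, I x -> J x -> x = 0;
  dec_neq1 : ~ sum_ideal I J 1;
  dec_unit : forall x, sum_ideal I J x \/ exists y, y * x = 1;
  dec_neq0l : exists x, I x /\ x <> 0;
  dec_neq0r : exists x, J x /\ x <> 0 }.

Lemma sum_idealC I J : sum_ideal I J = sum_ideal J I.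
Proof.
apply/funext => x; apply/propext.
by split=> -[a [b [Ia Jb ->]]]; exists b, a; split=> //; rewrite addrC.
Qed.

Lemma decomposable_localC I J :
  decomposable_local I J -> decomposable_local J I.
Proof.
case=> noeth iI iJ cap neq1 unit I0 J0; split; rewrite 1?sum_idealC //.
  by move=> x Jx Ix; apply: cap.
Qed.

Section Dec.
Variables I J : R -> Prop.
Hypothesis dec : decomposable_local I J.
Notation m := (sum_ideal I J).

Lemma sum_ideal_ideal : is_ideal m.
Proof.
have [[I0 ID IM] [J0 JD JM]] := (dec_ideall dec, dec_idealr dec).
split.
- by exists 0, 0; rewrite addr0.
- move=> _ _ [a [b [Ia Jb ->]]] [c [d [Ic Jd ->]]].
  by exists (a + c), (b + d); rewrite addrACA; split; auto.
- move=> r _ [a [b [Ia Jb ->]]].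
  by exists (r * a), (r * b); rewrite mulrDr; split; auto.
Qed.

Lemma sum_ideal_r b : J b -> m b.
Proof. by have [I0 _ _] := dec_ideall dec; exists 0, b; rewrite add0r. Qed.

Lemma dec_mul0 a b : I a -> J b -> a * b = 0.
Proof.
have [[_ _ IM] [_ _ JM]] := (dec_ideall dec, dec_idealr dec).
move=> Ia Jb; apply: (dec_cap dec); last exact: JM.
by rewrite mulrC; apply: IM.
Qed.

Lemma nakayama_fg (Z : lmodType R) : finitely_generated Z ->
  (exists z : Z, z <> 0) -> exists x : Z, ~ ideal_prod m (fun=> True) x.
Proof.
move=> [n [g gP]] [z z0]; apply/existsNP => mZ; apply: z0.
have gen : generates (fun _ : Z => True) g by [].
exact: (nakayama sum_ideal_ideal (dec_neq1 dec) (dec_unit dec) gen).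
Qed.

(** Since I J = 0, the product [ideal_prod m J] is J^2; this supplies the element of J outside
    J^2. *)
Lemma nakayama_r : exists b, J b /\ ~ @ideal_prod R R^o m J b.
Proof.
have [n [g gP]] := dec_noetherian dec (dec_idealr dec).
have gen : @generates R R^o J n g.
  by split=> [i|x]; [exact: ideal_generator gP i | move/gP].
apply: contrapT => JmJ; have [x [Jx]] := dec_neq0r dec; apply.
apply: (nakayama sum_ideal_ideal (dec_neq1 dec) (dec_unit dec) gen) => // b Jb.
by apply: contrapT => mJb; apply: JmJ; exists b.
Qed.

Lemma minimal_cover (Z : lmodType R) x : finitely_generated Z ->
    ~ ideal_prod m (fun _ : Z => True) x ->
  exists n (p : {linear 'rV[R]_n.+1 -> Z}), [/\ forall z, exists v, p v = z,
    p (delta_mx 0 0) = x & forall v, p v = 0 -> forall i, m (v 0 i)].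
Proof.
move=> [n [g gP]] xP; have gen : generates (fun _ : Z => True) g by [].
have [p [h [hx [_ hP] h0]]] :=
  minimal_generators_at sum_ideal_ideal (dec_unit dec) gen xP.
exists p, (lin_comb h); split=> [z||v v0]; last exact: h0.
  have [c ->] := hP z Logic.I; exists (\row_i c i).
  by apply: eq_bigr => i _; rewrite mxE.
by rewrite -hx; exact: lin_comb_delta.
Qed.

(** One stage of the iteration. The witness is [y] = b e_0 with b in J outside m J. The last two
    conclusions are the hypotheses for the next stage, with [I] and [J] exchanged. *)
Lemma minimal_cover_annihilated (Z : lmodType R) x : finitely_generated Z ->
    ~ ideal_prod m (fun _ : Z => True) x -> (forall b, J b -> b *: x = 0) ->
  exists n (p : {linear 'rV[R]_n.+1 -> Z}),
    [/\ forall z, exists v, p v = z,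
        forall v, p v = 0 -> forall i, m (v 0 i),
        forall b, J b -> p (b *: delta_mx 0 0) = 0
      & exists y : kernel p, ~ ideal_prod m (fun=> True) y /\
          forall a, I a -> a *: y = 0].
Proof.
move=> fgZ xP Jx; have [n [p [p_surj px p_min]]] := minimal_cover fgZ xP.
have pJ b : J b -> p (b *: delta_mx 0 0) = 0.
  by move=> /Jx; rewrite linearZ /= px.
exists n, p; split=> //.
have [b [Jb bP]] := nakayama_r.
have yP : b *: delta_mx 0 0 \in ker_pred p by rewrite unfold_in pJ.
exists (Kernel yP); split; last first.
  by move=> a Ia; apply: val_inj; rewrite /= scalerA (dec_mul0 Ia Jb) scale0r.
have [[I0 ID IM] [J0 JD JM]] := (dec_ideall dec, dec_idealr dec).
have [mJ0 mJD mJZ] := submodule_ideal_prod m (J : R^o -> Prop).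
(* Membership of [y] in m times the kernel is eliminated into the submodule of vectors whose
   coordinate 0 lies in I + m J. *)
move=> /(_ (fun z => exists c d,
  [/\ I c, @ideal_prod R R^o m J d & ker_val z 0 0 = c + d])) [].
- split=> [|u v|r u].
  + by exists 0, 0; rewrite mxE addr0.
  + move=> [a1 [b1 [Ia1 Jb1 uE]]] [a2 [b2 [Ia2 Jb2 vE]]].
    exists (a1 + a2), (b1 + b2); rewrite mxE uE vE addrACA.
    by split; [exact: ID | exact: mJD |].
  + move=> [a1 [b1 [Ia1 Jb1 uE]]]; exists (r * a1), (r * b1).
    by rewrite mxE uE mulrDr; split; [exact: IM | exact: mJZ |].
(* By minimality the coordinate of [z] is again in I + J, and the cross terms of the product vanish
   because I J = 0. *)
- move=> _ z [a1 [b1 [Ia1 Jb1 ->]]] _.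
  have [a2 [b2 [Ia2 Jb2 zE]]] := p_min _ (ker_valE z) 0.
  exists (a1 * a2), (b1 * b2); split; first exact: IM.
    by apply: (@ideal_prodM R R^o) => //; apply: sum_ideal_r.
  rewrite mxE zE mulrDl !mulrDr (dec_mul0 Ia1 Jb2) [b1 * a2]mulrC.
  by rewrite (dec_mul0 Ia2 Jb1) addr0 add0r.
(* Here b = c + d with d in m J, hence in J; so c = b - d lies in both I and J and is 0, which puts
   b in m J. *)
- move=> c [d [Ic mJd]]; rewrite /= !mxE !eqxx mulr1 => bE.
  have Jd : J d.
    apply: (mJd J (dec_idealr dec)) => r z _; exact: JM.
  have c0 : c = 0.
    apply: (dec_cap dec) => //; rewrite -(addrK d c) -bE.
    by apply: JD => //; rewrite -mulN1r; apply: JM.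
  by apply: bP; rewrite bE c0 add0r.
Qed.

(* Nothing is claimed about the values of [pr] outside [m]. *)
Lemma right_component : exists pr : R -> R,
  (forall a b, I a -> J b -> pr (a + b) = b).
Proof.
have /choice[pr prP] x : exists b, forall a b',
    I a -> J b' -> x = a + b' -> b = b'.
  have [[a [b [Ia Jb ->]]]|xP] := EM (m x).
    exists b => a' b' Ia' Jb' abE.
    have [[I0 ID IM] [J0 JD JM]] := (dec_ideall dec, dec_idealr dec).
    apply/eqP; rewrite -subr_eq0; apply/eqP; apply: (dec_cap dec).
      have -> : b - b' = a' - a.
        apply/eqP; rewrite subr_eq addrAC -abE.
        by rewrite addrAC subrr add0r.
      by apply: ID => //; rewrite -mulN1r; apply: IM.
    by apply: JD => //; rewrite -mulN1r; apply: JM.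
  by exists 0 => a b Ia Jb xE; case: xP; exists a, b.
by exists pr => a b Ia Jb; apply: (prP _ a).
Qed.

End Dec.

(** [Z] is the M_2 of the overview, and the kernels of [p2], [p3], [p4] are M_3, M_4, M_5. The
    elements [x], [y], [z] are killed by J, I, J in turn. *)
Lemma not_self_orthogonal I J (Z : lmodType R) x : decomposable_local I J ->
    finitely_generated Z ->
    ~ ideal_prod (sum_ideal I J) (fun _ : Z => True) x ->
    (forall b, J b -> b *: x = 0) ->
  ~ self_orthogonal Z.
Proof.
move=> dec fgZ xP Jx orthZ; have decC := decomposable_localC dec.
have noethR := dec_noetherian dec.
have [n2 [p2 [p2_surj p2_min p2J [y [yP Iy]]]]] :=
  minimal_cover_annihilated dec fgZ xP Jx.
have fg3 := finitely_generated_kernel p2 noethR.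
rewrite sum_idealC in yP.
have [n3 [p3 [p3_surj _ _ [z [zP Jz]]]]] :=
  minimal_cover_annihilated decC fg3 yP Iy.
have fg4 := finitely_generated_kernel p3 noethR.
rewrite sum_idealC in zP.
have [n4 [p4 [p4_surj p4_min p4J _]]] :=
  minimal_cover_annihilated dec fg4 zP Jz.
(* Dimension shifting turns this group into Ext^2(M_3, M_3), which vanishes because M_3 is again
   self-orthogonal. *)
have Ext43 : Ext_eq0 1 (kernel p3) (kernel p2).
  apply: Ext_eq0_kernel => //; first exact: rV_projective.
  exact: (self_orthogonal_kernel p2_surj orthZ (isT : 1 <= 2)%N).1.
have [pr prE] := right_component dec.
have [[I0 ID IM] [J0 JD JM]] := (dec_ideall dec, dec_idealr dec).
(* Minimality of [p4] keeps coordinate 0 in I + J, where [pr] is the projection to J and hence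
   linear. *)
pose phi (w : kernel p4) : 'rV[R]_n2.+1 := pr (ker_val w 0 0) *: delta_mx 0 0.
have phi_lin : linear phi.
  move=> r u v; rewrite /phi.
  have [a1 [b1 [Ia1 Jb1 uE]]] := p4_min _ (ker_valE u) 0.
  have [a2 [b2 [Ia2 Jb2 vE]]] := p4_min _ (ker_valE v) 0.
  have -> : ker_val (r *: u + v) 0 0 = (r * a1 + a2) + (r * b1 + b2).
    by rewrite !mxE uE vE mulrDr addrACA.
  by rewrite uE vE !prE ?scalerDl ?scalerA //; [apply: ID | apply: JD]; auto.
pose phiL := GRing.isLinear.Build R (kernel p4) 'rV[R]_n2.+1 _ phi phi_lin.
pose phi' : {linear kernel p4 -> 'rV[R]_n2.+1} := HB.pack phi phiL.
have phi0 w : p2 (phi' w) = 0.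
  have [a [b [Ia Jb wE]]] := p4_min _ (ker_valE w) 0.
  by rewrite /= /phi wE prE // p2J.
have [g gE] :=
  Ext1_eq0_extend p4_surj (corestr phi0) (@rV_projective R n4.+1) Ext43.
(* [t] lies in the maximal ideal because the cover [p2] is minimal, so [1 - t] is a unit. *)
pose t := ker_val (g (delta_mx 0 0)) 0 0.
have [s st] : exists s, s * (1 - t) = 1.
  apply: (unit_subr (sum_ideal_ideal dec) (dec_neq1 dec) (dec_unit dec)).
  exact: p2_min (ker_valE _) _.
(* Since J e_0 lies in M_5, comparing the map with its extension at u e_0 gives u = u t; the unit
   [1 - t] then forces u = 0. *)
have [u [Ju]] := dec_neq0r dec; apply.
have uP : u *: delta_mx 0 0 \in ker_pred p4 by rewrite unfold_in p4J.
have /(congr1 (fun w : kernel p2 => ker_val w 0 0)) := gE (Kernel uP).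
rewrite /= /phi /= linearZ /= !mxE !eqxx !mulr1 -/t -[u in pr u]add0r prE //.
move=> ut.
by rewrite -[u]mul1r -st mulrAC -mulrA mulrBr mulr1 -ut subrr mulr0.
Qed.

Theorem decomposable_local_self_orthogonal_free I J (M : lmodType R) :
    decomposable_local I J -> finitely_generated M -> self_orthogonal M ->
  is_free M.
Proof.
move=> dec fgM orthM; have noethR := dec_noetherian dec.
(* The zero module is treated apart, with a cover of rank 0: [minimal_cover] starts from an element
   outside m M and has positive rank. *)
have [M0|/existsNP M_neq0] := EM (forall x : M, x = 0).
  apply: (@is_free_rV _ M 0 \0) => [x|v _]; first by exists 0; rewrite (M0 x).
  exact: thinmx0.
have [x0 x0P] := nakayama_fg dec fgM M_neq0.
have [n0 [p0 [p0_surj _ p0_min]]] := minimal_cover dec fgM x0P.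
have [Z1_0|/existsNP Z1_neq0] := EM (forall z : kernel p0, z = 0).
  apply: is_free_rV p0_surj _ => v v0.
  have vP : v \in ker_pred p0 by rewrite unfold_in v0.
  by have /(congr1 val) := Z1_0 (Kernel vP).
have fg1 := finitely_generated_kernel p0 noethR.
have [x1 x1P] := nakayama_fg dec fg1 Z1_neq0.
have [n1 [p1 [p1_surj _ p1_min]]] := minimal_cover dec fg1 x1P.
have [mI0 mID mIM] := sum_ideal_ideal dec.
have [Z2_0|/existsNP Z2_neq0] := EM (forall z : kernel p1, z = 0).
  (* [q] inverts [p1] and extends over the free cover of M. Elements of the first syzygy have
     coordinates in m, so e_0 = q (p1 e_0) has its coordinate 1 in m. *)
  have [|q qE] := linear_factor (f := idfun) p1_surj.
    move=> v v0; have vP : v \in ker_pred p1 by rewrite unfold_in v0.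
    by have /(congr1 val) := Z2_0 (Kernel vP).
  have Ext1 : Ext_eq0 1 M 'rV[R]_n1.+1 by apply/Ext_eq0_rV/(orthM 1 isT).2.
  have [h hE] := Ext1_eq0_extend p0_surj q (@rV_projective R n0.+1) Ext1.
  case: (dec_neq1 dec).
  have /(congr1 (fun v : 'rV_n1.+1 => v 0 0)) := qE (delta_mx 0 0).
  rewrite hE /= mxE !eqxx -[(_ && _)%:R]/(1 : R) linear_rVE summxE => <-.
  apply: big_ind => // i _; rewrite mxE mulrC; apply: mIM.
  exact: p0_min (ker_valE _) _.
have fg2 := finitely_generated_kernel p1 noethR.
have [x2 x2P] := nakayama_fg dec fg2 Z2_neq0.
have orth2 : self_orthogonal (kernel p1).
  by apply/self_orthogonal_kernel/self_orthogonal_kernel.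
(* Minimality of [p1] allows every coordinate of [x2] to be split along I + J. *)
have /fin_all_exists[a /fin_all_exists[b abP]] i :
  sum_ideal I J (ker_val x2 0 i) by exact: p1_min (ker_valE _) _.
have [[I0 ID IM] [J0 JD JM]] := (dec_ideall dec, dec_idealr dec).
pose va : 'rV[R]_n1.+1 := \row_i a i; pose vb : 'rV[R]_n1.+1 := \row_i b i.
have x2E : ker_val x2 = va + vb.
  by apply/rowP=> i; rewrite !mxE; have [] := abP i.
have coordE (v : 'rV[R]_n1.+1) i :
    ker_val (p1 v) 0 i = \sum_j v 0 j * ker_val (p1 (delta_mx 0 j)) 0 i.
  rewrite linear_rVE linear_sum summxE; apply: eq_bigr => j _.
  by rewrite linearZ mxE.
(* [p1 va = - p1 vb] has its coordinates both in [I] and in [J]. *)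
have pa_coord i : ker_val (p1 va) 0 i = 0.
  apply: (dec_cap dec).
    rewrite coordE; apply: (big_ind I) => // j _.
    by rewrite mxE mulrC; apply: IM; have [] := abP j.
  have -> : p1 va = - p1 vb.
    by apply/eqP; rewrite -addr_eq0 -linearD -x2E ker_valE.
  rewrite -linearN coordE; apply: (big_ind J) => // j _.
  by rewrite !mxE mulNr -mulrN mulrC; apply: JM; have [] := abP j.
have pa : p1 va = 0.
  by apply: val_inj; apply/rowP=> i; rewrite [RHS]mxE; exact: pa_coord.
have pb : p1 vb = 0 by have := ker_valE x2; rewrite x2E linearD pa add0r.
have aP : va \in ker_pred p1 by rewrite unfold_in pa.
have bP : vb \in ker_pred p1 by rewrite unfold_in pb.
have Ja c : J c -> c *: Kernel aP = 0.
  move=> Jc; apply: val_inj; apply/rowP=> i; rewrite !mxE mulrC.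
  by apply: (dec_mul0 dec) => //; have [] := abP i.
have Ib c : I c -> c *: Kernel bP = 0.
  move=> Ic; apply: val_inj; apply/rowP=> i; rewrite !mxE.
  by apply: (dec_mul0 dec) => //; have [] := abP i.
(* [x2] is the sum of its two parts and lies outside m M_2, so at least one part does too; when it
   is the J-part, [I] and [J] are exchanged. *)
have [ma|ma] := EM (ideal_prod (sum_ideal I J) (fun=> True) (Kernel aP)).
  have decC := decomposable_localC dec.
  case: (not_self_orthogonal decC fg2 _ Ib orth2); rewrite sum_idealC => mb.
  apply: x2P; have -> : x2 = Kernel aP + Kernel bP by apply: val_inj.
  by have [_ mD _] := submodule_ideal_prod (sum_ideal I J)
    (fun _ : kernel p1 => True); apply: mD.
by case: (not_self_orthogonal dec fg2 ma Ja orth2).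
Qed.

End DecomposableMaximalIdeal.

(** * Fiber products *)

(** Locality is stated as uniqueness of the maximal ideal. Zorn's lemma puts a non-unit in some
    maximal ideal, which must be [m]. *)
Lemma local_at_unit (A : comNzRingType) (m : A -> Prop) x :
  local_at m -> ~ m x -> exists y, y * x = 1.
Proof.
move=> [_ m_uniq] mx; apply: contrapT => xNunit.
pose proper_at (X : set A) := [/\ is_ideal X, X x & ~ X 1].
(* Zorn_bigcup also asks for the union of the empty chain. *)
pose P (X : set A) := X = set0 \/ proper_at X.
have PE (X : set A) y : P X -> X y -> proper_at X by case=> // ->.
have [F FP totF|X [PX maxX]] := @Zorn_bigcup A P.
  have [[X [FX X0]]|F0] := EM (exists X, F X /\ exists z, X z); last first.
    left; apply/seteqP; split=> // y [X FX Xy].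
    by case: F0; exists X; split=> //; exists y.
  have [y Xy] := X0; have [[XI0 _ _] Xx _] := PE X y (FP X FX) Xy.
  right; split.
  - split; first by exists X.
      move=> u v [U FU Uu] [V FV Vv].
      have [[_ UD _] _ _] := PE U u (FP U FU) Uu.
      have [[_ VD _] _ _] := PE V v (FP V FV) Vv.
      have [UV|VU] := totF U V FU FV.
        by exists V => //; apply: VD => //; apply: UV.
      by exists U => //; apply: UD => //; apply: VU.
    move=> a u [U FU Uu]; exists U => //.
    by have [[_ _ UM] _ _] := PE U u (FP U FU) Uu; apply: UM.
  - by exists X.
  - by move=> [U FU U1]; have [_ _] := PE U 1 (FP U FU) U1.
have Pprinc : P (fun z => exists a, z = a * x).
  right; split; last by move=> [a a1]; apply: xNunit; exists a.
    split; first by exists 0; rewrite mul0r.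
      by move=> _ _ [a ->] [b ->]; exists (a + b); rewrite mulrDl.
    by move=> a _ [b ->]; exists (a * b); rewrite mulrA.
  by exists 1; rewrite mul1r.
(* The maximal element is not the empty set, since the principal ideal of [x] is strictly larger. *)
case: PX => [X0|[idX Xx X1]].
  apply: (maxX _ _ Pprinc); rewrite X0; split=> // sub0.
  by case: (sub0 x); exists 1; rewrite mul1r.
apply/mx/(m_uniq X) => //; split=> // J idJ XJ J1 z Jz.
apply: contrapT => Xz; apply: (maxX J); first by split=> // /(_ z Jz).
by right; split=> //; apply: XJ.
Qed.

Section FiberProductLocal.
Variables (k : fieldType) (S T : comNzRingType).
Variables (piS : {rmorphism S -> k}) (piT : {rmorphism T -> k}).
Notation R := (fiber_product piS piT).

Lemma fiber_valE (r : R) : piS (fiber_val r).1 = piT (fiber_val r).2.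
Proof. by case: r => [[s t] /= /eqP]. Qed.

Lemma fiber_lift s t : piS s = piT t -> exists r : R, fiber_val r = (s, t).
Proof.
move=> st; have stP : (s, t) \in fiber_pred piS piT.
  by rewrite unfold_in /=; apply/eqP.
by exists (FiberProduct stP).
Qed.

(** The first component is then in the kernel of [piS], so this is the summand m_S of the maximal
    ideal. *)
Definition fiber_idealS (r : R) : Prop := (fiber_val r).2 = 0.
Definition fiber_idealT (r : R) : Prop := (fiber_val r).1 = 0.

Variables (mS : S -> Prop) (mT : T -> Prop).
Hypotheses (hS : noetherian_local_ring mS piS).
Hypotheses (hT : noetherian_local_ring mT piT).

(** Generators of the image of [K] in S, lifted to [K], and generators of the part of [K] over 0 in
    S generate [K] together. Surjectivity of [piS] and [piT] lifts scalars of S and T to the fiber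
    product. *)
Lemma fiber_noetherian : noetherian R.
Proof.
have [noethS _ piS_surj _] := hS; have [noethT _ piT_surj _] := hT.
move=> K [K0 KD KM].
have [|n [g gP]] := noethS (fun s => exists r : R, K r /\ (fiber_val r).1 = s).
  split; first by exists 0.
    move=> _ _ [r [Kr <-]] [r' [Kr' <-]]; exists (r + r').
    by split; [exact: KD |].
  move=> s _ [r [Kr <-]]; have [t tE] := piT_surj (piS s).
  have [a aE] := fiber_lift (esym tE).
  by exists (a * r); split; [exact: KM | rewrite /= aE].
have [|p [h hP]] :=
  noethT (fun t => exists r : R, K r /\ fiber_val r = (0, t)).
  split; first by exists 0.
    move=> t t' [r [Kr rE]] [r' [Kr' rE']]; exists (r + r').
    by split; [exact: KD | rewrite /= rE rE'; congr pair; exact: addr0].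
  move=> t t' [r [Kr rE]]; have [s sE] := piS_surj (piT t).
  have [a aE] := fiber_lift sE.
  exists (a * r); split; first exact: KM.
  by rewrite /= aE rE; congr pair; exact: mulr0.
have /fin_all_exists[G GP] i : exists r : R, K r /\ (fiber_val r).1 = g i.
  exact: ideal_generator gP i.
have /fin_all_exists[H HP] i : exists r : R, K r /\ fiber_val r = (0, h i).
  exact: ideal_generator hP i.
pose GH (i : 'I_(n + p)) :=
  match split i with inl j => G j | inr j => H j end.
exists (n + p)%N, GH => x; split=> [Kx|[c ->]]; last first.
  apply: (big_ind K) => // i _; apply: KM; rewrite /GH.
  by case: split => j; [exact: (GP j).1 | exact: (HP j).1].
have [|c cE] := (gP (fiber_val x).1).1; first by exists x.
have /fin_all_exists[C CP] i : exists r : R, (fiber_val r).1 = c i.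
  have [t tE] := piT_surj (piS (c i)); have [r rE] := fiber_lift (esym tE).
  by exists r; rewrite rE.
pose y := x - \sum_i C i * G i.
have Ky : K y.
  apply: (KD) => //; rewrite -mulN1r; apply: (KM).
  by apply: (big_ind K) => // i _; apply: KM; have [] := GP i.
pose p1 (r : R) := (fiber_val r).1; pose p2 (r : R) := (fiber_val r).2.
have p1_sum q (F : 'I_q -> R) : p1 (\sum_i F i) = \sum_i p1 (F i).
  exact: (big_morph p1).
have p2_sum q (F : 'I_q -> R) : p2 (\sum_i F i) = \sum_i p2 (F i).
  exact: (big_morph p2).
have y1 : p1 y = 0.
  have -> : p1 y = p1 x - p1 (\sum_i C i * G i) by [].
  rewrite p1_sum /p1 cE; apply/eqP; rewrite subr_eq0; apply/eqP/eq_bigr => i _.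
  by rewrite -(CP i) -(GP i).2.
have [|d dE] := (hP (p2 y)).1.
  by exists y; split=> //; rewrite [LHS]surjective_pairing -/(p1 y) y1.
have /fin_all_exists[D DP] i : exists r : R, (fiber_val r).2 = d i.
  have [s sE] := piS_surj (piT (d i)); have [r rE] := fiber_lift sE.
  by exists r; rewrite rE.
have yE : y = \sum_i D i * H i.
  apply: val_inj; rewrite [LHS]surjective_pairing [RHS]surjective_pairing.
  rewrite -!/(p1 _) -!/(p2 _) y1 p1_sum p2_sum dE; congr pair.
    by rewrite big1 // => i _; rewrite /p1 /= (HP i).2 /= mulr0.
  by apply: eq_bigr => i _; rewrite /p2 /= (HP i).2 DP.
exists (fun i => match split i with inl j => C j | inr j => D j end).
rewrite big_split_ord /=.
under eq_bigr do rewrite /GH (unsplitK (inl _)).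
under [X in _ + X]eq_bigr do rewrite /GH (unsplitK (inr _)).
by rewrite -yE addrC subrK.
Qed.

Lemma fiber_decomposable_local :
    (exists s, mS s /\ s <> 0) -> (exists t, mT t /\ t <> 0) ->
  decomposable_local fiber_idealS fiber_idealT.
Proof.
have [_ locS piS_surj mSE] := hS; have [_ locT piT_surj mTE] := hT.
move=> [s0 [ms0 s0_neq0]] [t0 [mt0 t0_neq0]]; split.
- exact: fiber_noetherian.
- split=> [|x y|a x]; rewrite /fiber_idealS //= => ->.
    by move=> ->; exact: addr0.
  exact: mulr0.
- split=> [|x y|a x]; rewrite /fiber_idealT //= => ->.
    by move=> ->; exact: addr0.
  exact: mulr0.
- by move=> r r2 r1; apply: val_inj; rewrite [LHS]surjective_pairing r1 r2.
(* Applying [piS] to the first component of 1 = a + b yields 1 = 0 in k. *)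
- move=> [a [b [a2 b1 /(congr1 (fun r : R => piS (fiber_val r).1))]]].
  rewrite rmorph1 /= rmorphD b1 rmorph0 addr0 fiber_valE a2 rmorph0.
  by move/eqP; rewrite oner_eq0.
(* If the common residue is 0, the pair splits as (s, 0) + (0, t). Otherwise both components are
   units, and their inverses agree in k, being inverse to the same residue. *)
- move=> r; have [s0r|sN0] := EM (piS (fiber_val r).1 = 0).
    left; have [|a aE] := @fiber_lift (fiber_val r).1 0.
      by rewrite rmorph0.
    have [|b bE] := @fiber_lift 0 (fiber_val r).2.
      by rewrite -fiber_valE s0r rmorph0.
    exists a, b; rewrite /fiber_idealS /fiber_idealT aE bE; split=> //.
    apply: val_inj; rewrite /= aE bE [LHS]surjective_pairing.
    by congr pair; rewrite /= ?addr0 ?add0r.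
  right; have [|s sE] := local_at_unit locS (x := (fiber_val r).1).
    by move/mSE.
  have [|t tE] := local_at_unit locT (x := (fiber_val r).2).
    by move/mTE; rewrite -fiber_valE.
  have [|q qE] := @fiber_lift s t.
    apply: (mulIf (introN eqP sN0)).
    by rewrite -rmorphM sE fiber_valE -rmorphM tE !rmorph1.
  exists q; apply: val_inj; rewrite /= qE [LHS]surjective_pairing /=.
  by rewrite sE tE.
- have [|r rE] := @fiber_lift s0 0; first by rewrite (mSE _).1 ?rmorph0.
  exists r; rewrite /fiber_idealS rE; split=> // r0.
  by apply: s0_neq0; move: rE; rewrite r0 => -[].
- have [|r rE] := @fiber_lift 0 t0; first by rewrite (mTE _).1 ?rmorph0.
  exists r; rewrite /fiber_idealT rE; split=> // r0.
  by apply: t0_neq0; move: rE; rewrite r0 => -[].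
Qed.

End FiberProductLocal.

(** * Ext into a direct sum, and conclusion for the fiber product *)

Lemma Ext_eq0_retract (R : nzRingType) i (M N N' : lmodType R)
    (u : {linear N -> N'}) (v : {linear N' -> N}) :
  cancel u v -> Ext_eq0 i.+1 M N' -> Ext_eq0 i.+1 M N.
Proof.
move=> uK H P f f0; have [x|g gE] := H P (u \o f).
  by rewrite /= f0 linear0.
by exists (v \o g) => x; rewrite /= -gE /= uK.
Qed.

Lemma Ext_eq0_prod (R : nzRingType) i (M N N' : lmodType R) :
  Ext_eq0 i.+1 M (N * N')%type -> Ext_eq0 i.+1 M N /\ Ext_eq0 i.+1 M N'.
Proof.
have inl_lin : linear (fun x : N => (x, 0) : N * N').
  by move=> a x y; congr pair; rewrite /= scaler0 addr0.
have inr_lin : linear (fun x : N' => (0, x) : N * N').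
  by move=> a x y; congr pair; rewrite /= scaler0 addr0.
pose inlL := GRing.isLinear.Build R N (N * N')%type _ _ inl_lin.
pose inrL := GRing.isLinear.Build R N' (N * N')%type _ _ inr_lin.
pose inl' : {linear N -> (N * N')%type} :=
  HB.pack (fun x : N => (x, 0) : N * N') inlL.
pose inr' : {linear N' -> (N * N')%type} :=
  HB.pack (fun x : N' => (0, x) : N * N') inrL.
move=> H; split.
  exact: (@Ext_eq0_retract _ _ _ _ _ inl' fst).
exact: (@Ext_eq0_retract _ _ _ _ _ inr' snd).
Qed.

Theorem theorem1p2 (k : fieldType) (S T : comNzRingType)
    (mS : S -> Prop) (mT : T -> Prop)
    (piS : {rmorphism S -> k}) (piT : {rmorphism T -> k})
    (hS : noetherian_local_ring mS piS) (hT : noetherian_local_ring mT piT)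
    (mS_neq0 : exists s, mS s /\ s <> 0) (mT_neq0 : exists t, mT t /\ t <> 0)
    (M : lmodType (fiber_product piS piT)) (hM : finitely_generated M)
    (hExt : forall i : nat, (1 <= i)%N ->
       Ext_eq0 i M (M * (fiber_product piS piT)^o)%type) :
  is_free M.
Proof.
have dec := fiber_decomposable_local hS hT mS_neq0 mT_neq0.
apply: (decomposable_local_self_orthogonal_free dec hM) => -[//|i] _.
exact: Ext_eq0_prod (hExt i.+1 isT).
Qed.
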